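(* Assume: (i) $\mathcal X\subseteq\mathcal D$, $\mathbf x_0=\mathbf x_1\in\mathcal X$; (ii) all $h_i$ $(1\le i\le I)$ and all $g_j$ $(1\le j\le J)$ are $L$-smooth and $G$-Lipschitz; (iii) (parameterized $(\chi,\rho)$-MFCQ) $\chi\ge 0$ and $\rho>0$ are such that for every $\tilde{\mathbf x}\in\mathcal X$ there is $\mathbf d\in\mathbb R^n$ with $\|\mathbf d\|=1$, $\langle\nabla g_j(\tilde{\mathbf x}),\mathbf d\rangle\le-\rho$ for every $j$ with $g_j(\tilde{\mathbf x})\ge-\chi$, and $\langle\nabla h_i(\tilde{\mathbf x}),\mathbf d\rangle\le-\rho$ for every $i$ with $h_i(\tilde{\mathbf x})\ge-\chi$; moreover $\chi\ge\frac{\rho}{L}(G+\rho/2)$; (iv) for each $\mathbf y\in\mathcal X$ and each $\boldsymbol\xi$, the surrogate $\hat f(\cdot,\mathbf y,\boldsymbol\xi)$ is $\mu$-strongly convex and $L$-smooth, and $\nabla\hat f(\mathbf x,\mathbf x,\boldsymbol\xi)=\nabla f(\mathbf x,\boldsymbol\xi)$ for all $\mathbf x\in\mathcal X$; (v) for each $\mathbf y\in\mathcal X$ and each $j$, the surrogate $\tilde g_j(\cdot,\mathbf y)$ is convex, $L$-smooth and $G$-Lipschitz in $\mathcal X$, $\nabla\tilde g_j(\mathbf y,\mathbf y)=\nabla g_j(\mathbf y)$, and $g_j(\mathbf x)\le\tilde g_j(\mathbf x,\mathbf y)$ for all $\mathbf x\in\mathcal X$ with equality at $\mathbf x=\mathbf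 y$; (vi) for all $t\ge1$ and all $\mathbf x\in\mathcal X$, $\tilde f(\mathbf x,\mathbf x_t,\mathbf z_t,\boldsymbol\xi_t)+u(\mathbf x)-\min_{\mathbf x'\in\mathcal X(\mathbf x_t)}\big(\tilde f(\mathbf x',\mathbf x_t,\mathbf z_t,\boldsymbol\xi_t)+u(\mathbf x')\big)\le B_U$. Then for every $t\ge1$ the optimal dual variables $(\hat{\boldsymbol\lambda}_t,\hat{\boldsymbol\nu}_t)$ of the $t$-th CoSTA subproblem satisfy $$\|\hat{\boldsymbol\lambda}_t\|_1+\|\hat{\boldsymbol\nu}_t\|_1\le\frac{2B_UL}{\rho^2}.$$
   Context: Problem. $U(\mathbf x)=\mathbb E[f(\mathbf x,\boldsymbol\xi)]$ with $f(\cdot,\boldsymbol\xi)$ differentiable, possibly non-convex, and $\boldsymbol\xi$ a random variable; $u$ is convex; $h_1,\dots,h_I$ are smooth convex functions and $g_1,\dots,g_J$ smooth, possibly non-convex functions on $\mathbb R^n$. Let $F=U+u$, $\mathcal K=\{\mathbf x\in\mathbb R^n: h_i(\mathbf x)\le0\ \forall i\}$, $\mathcal X=\mathcal K\cap\{\mathbf x: g_j(\mathbf x)\le0\ \forall j\}$, and $\mathcal D=\mathrm{dom}(F)\cap\bigcap_j\mathrm{dom}(g_j)\cap\bigcap_i\mathrm{dom}(h_i)$; $F$ is bounded below on $\mathcal X$. $L$-smooth means differentiable with $L$-Lipschitz gradient; norms without subscript are Euclidean. CoSTA algorithm. Parameters $\bar k,w,c>0$; i.i.d. samples $\boldsymbol\xi_1,\boldsymbol\xi_2,\dots$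 of $\boldsymbol\xi$; start $\mathbf x_0=\mathbf x_1\in\mathcal X$ and $\mathbf z_1=\nabla f(\mathbf x_0,\boldsymbol\xi_1)$. With $G_t=\|\nabla f(\mathbf x_t,\boldsymbol\xi_t)\|$ put $\eta_0=\bar k/w^{1/3}<1$, $\eta_t=\bar k/(w+\sum_{i=1}^tG_i^2)^{1/3}$ for $t\ge1$, and $\beta_{t+1}=c\eta_t^2<1$ for $t\ge 0$. For $t=1,2,\dots$: $\mathbf z_{t+1}=\nabla f(\mathbf x_t,\boldsymbol\xi_t)+(1-\beta_t)(\mathbf z_t-\nabla f(\mathbf x_{t-1},\boldsymbol\xi_t))$; $\hat{\mathbf x}_t=\arg\min_{\mathbf x\in\mathcal X(\mathbf x_t)}\tilde f(\mathbf x,\mathbf x_t,\mathbf z_t,\boldsymbol\xi_t)+u(\mathbf x)$ (the $t$-th subproblem), where $\tilde f(\mathbf x,\mathbf x_t,\mathbf z_t,\boldsymbol\xi_t)=\hat f(\mathbf x,\mathbf x_t,\boldsymbol\xi_t)+(1-\beta_t)\langle\mathbf x-\mathbf x_t,\mathbf z_t-\nabla f(\mathbf x_{t-1},\boldsymbol\xi_t)\rangle$ and $\mathcal X(\mathbf y)=\mathcal K\cap\{\mathbf x:\tilde g_j(\mathbf x,\mathbf y)\le0\ \forall j\}$; $\mathbf x_{t+1}=(1-\eta_t)\mathbf x_t+\eta_t\hat{\mathbf x}_t$. Here $\hat f(\cdot,\mathbf y,\boldsymbol\xi)$ and $\tilde g_j(\cdot,\mathbf y)$ are user-chosen surrogates.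 The subproblem is a convex problem: $\mathcal X(\mathbf y)$ is a convex set, the $\tilde g_j(\cdot,\mathbf y)$ are convex on it, and $\mathcal X(\mathbf y)\subseteq\mathcal X$ for $\mathbf y\in\mathcal X$. Dual variables. $(\hat{\mathbf x}_t,\hat{\boldsymbol\lambda}_t,\hat{\boldsymbol\nu}_t)$ is the primal-dual optimum of the $t$-th subproblem, with $\hat{\boldsymbol\lambda}_t\in\mathbb R^J$ associated with the constraints $\tilde g_j(\cdot,\mathbf x_t)\le0$ and $\hat{\boldsymbol\nu}_t\in\mathbb R^I$ with $h_i\le0$; i.e. it satisfies the KKT conditions: $\tilde g_j(\hat{\mathbf x}_t,\mathbf x_t)\le0$, $h_i(\hat{\mathbf x}_t)\le0$, $\hat{\boldsymbol\lambda}_t\ge0$, $\hat{\boldsymbol\nu}_t\ge0$, $[\hat{\boldsymbol\lambda}_t]_j\tilde g_j(\hat{\mathbf x}_t,\mathbf x_t)=0$, $[\hat{\boldsymbol\nu}_t]_ih_i(\hat{\mathbf x}_t)=0$ for all $i,j$, and $\nabla\tilde f(\hat{\mathbf x}_t,\mathbf x_t,\mathbf z_t,\boldsymbol\xi_t)+\mathbf v+\sum_j[\hat{\boldsymbol\lambda}_t]_j\nabla\tilde g_j(\hat{\mathbf x}_t,\mathbf x_t)+\sum_i[\hat{\boldsymbol\nu}_t]_i\nabla h_i(\hat{\mathbf x}_t)=0$ for some $\mathbf v\in\partial u(\hat{\mathbf x}_t)$ (gradients in the first argument). *)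

(* Defs.v *)
From HB Require Import structures.
From mathcomp Require Export all_boot all_order all_algebra.
From mathcomp Require Export all_classical all_reals all_analysis.
Export Order.TTheory GRing.Theory Num.Theory.
Export numFieldNormedType.Exports.

Set Implicit Arguments.
Unset Strict Implicit.
Unset Printing Implicit Defensive.

Local Open Scope classical_set_scope.
Local Open Scope ring_scope.

Section euclidean.
Context {R : realType} {n : nat}.
Implicit Types (x y v : 'rV[R]_n) (A : set 'rV[R]_n) (phi : 'rV[R]_n -> R).

Definition dot x y : R := \sum_(i < n) x ord0 i * y ord0 i.

(* The library's norm [`|x|] on row vectors is the sup norm. *)
Definition enorm x : R := Num.sqrt (dot x x).

Definition norm1 x : R := \sum_(i < n) `|x ord0 i|.

(* The partial derivatives; meaningful where [phi] is differentiable. *)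
Definition grad phi x : 'rV[R]_n := \row_(i < n) 'D_(delta_mx ord0 i) phi x.

Definition lipschitz_in A (G : R) phi : Prop :=
  forall x y, A x -> A y -> `|phi x - phi y| <= G * enorm (x - y).

(* Differentiability at a point of [A] is that of [phi] on the whole space. *)
Definition smooth_in A (L : R) phi : Prop :=
  (forall x, A x -> differentiable phi x) /\
  (forall x y, A x -> A y ->
     enorm (grad phi x - grad phi y) <= L * enorm (x - y)).

(* Convexity on a set that need not be convex: the convexity inequality is
   required only along segments that stay in the set. *)
Definition convex_in A phi : Prop :=
  forall C : set 'rV[R]_n, @convex_set R 'rV[R]_n C -> C `<=` A ->
    @convex_function R 'rV[R]_n C phi.

Definition strongly_convex (mu : R) phi : Prop :=
  forall x y (a : R), 0 <= a <= 1 ->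
    phi (a *: x + (1 - a) *: y) <=
      a * phi x + (1 - a) * phi y
      - mu / 2 * (a * (1 - a)) * enorm (x - y) ^+ 2.

Local Open Scope ereal_scope.

(* Convex functions with values in ]-oo, +oo]. *)
Definition econvex (u : 'rV[R]_n -> \bar R) : Prop :=
  (forall x, u x != -oo) /\
  (forall x y (a : R), (0 <= a <= 1)%R ->
     u (a *: x + (1 - a) *: y)%R <= a%:E * u x + (1 - a)%:E * u y).

Definition subdifferential (u : 'rV[R]_n -> \bar R) x : set 'rV[R]_n :=
  [set v | forall y, u x + (dot v (y - x)%R)%:E <= u y].

Definition edom (phi : 'rV[R]_n -> \bar R) : set 'rV[R]_n :=
  [set x | phi x \is a fin_num].

Definition is_argmin A (phi : 'rV[R]_n -> \bar R) x : Prop :=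
  A x /\ forall y, A y -> phi x <= phi y.

End euclidean.

Section iid.
Context {R : realType} {d d' : measure_display}
  {Omega : measurableType d} {Xi : measurableType d'}
  (P : probability Omega R).

Definition identically_distributed (X Y : {RV P >-> Xi}) : Prop :=
  forall B, measurable B -> distribution P X B = distribution P Y B.

(* Mutual independence of the samples with positive index. *)
Definition mutually_independent (X : nat -> {RV P >-> Xi}) : Prop :=
  forall (s : seq nat) (B : nat -> set Xi),
    uniq s -> (forall t, t \in s -> (0 < t)%N) ->
    (forall t, measurable (B t)) ->
    fine (P (\bigcap_(t in [set` s]) (X t @^-1` B t))) =
    \prod_(t <- s) fine (P (X t @^-1` B t)).

Definition iid_samples (xi : {RV P >-> Xi}) (X : nat -> {RV P >-> Xi}) : Prop :=
  (forall t, (0 < t)%N -> identically_distributed (X t) xi) /\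
  mutually_independent X.

End iid.

Section problem.
Context {R : realType} {n I J : nat} {d d' : measure_display}
  {Omega : measurableType d} {Xi : measurableType d'}.
Implicit Types (f : 'rV[R]_n -> Xi -> R) (u : 'rV[R]_n -> \bar R)
  (h : 'I_I -> 'rV[R]_n -> R) (g : 'I_J -> 'rV[R]_n -> R)
  (gt : 'I_J -> 'rV[R]_n -> 'rV[R]_n -> R).

Definition objective (P : probability Omega R) (xi : {RV P >-> Xi}) f u :
    'rV[R]_n -> \bar R :=
  fun x => ('E_P[fun w => f x (xi w)] + u x)%E.

Definition setK h : set 'rV[R]_n := [set x | forall i, h i x <= 0].

Definition feasible h g : set 'rV[R]_n :=
  setK h `&` [set x | forall j, g j x <= 0].

Definition approx_feasible h gt (y : 'rV[R]_n) : set 'rV[R]_n :=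
  setK h `&` [set x | forall j, gt j x y <= 0].

Definition domain (F : 'rV[R]_n -> \bar R) h g : set 'rV[R]_n :=
  edom F `&` \bigcap_(j in [set: 'I_J]) edom (EFin \o g j)
         `&` \bigcap_(i in [set: 'I_I]) edom (EFin \o h i).

Definition mfcq h g (chi rho : R) : Prop :=
  forall x, feasible h g x -> exists v : 'rV[R]_n,
    [/\ enorm v = 1,
        forall j, - chi <= g j x -> dot (grad (g j) x) v <= - rho &
        forall i, - chi <= h i x -> dot (grad (h i) x) v <= - rho].

End problem.

Section costa.
Context {R : realType} {n I J : nat} {Xi : Type}.
Variables (f : 'rV[R]_n -> Xi -> R) (u : 'rV[R]_n -> \bar R).
Variables (h : 'I_I -> 'rV[R]_n -> R) (g : 'I_J -> 'rV[R]_n -> R).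
(* [fh x y s] and [gt j x y] are the surrogates built at the base point [y]. *)
Variables (fh : 'rV[R]_n -> 'rV[R]_n -> Xi -> R).
Variables (gt : 'I_J -> 'rV[R]_n -> 'rV[R]_n -> R).
Variables (kbar w c : R).
(* A realisation of the samples, and the iterates along it. *)
Variables (s : nat -> Xi) (x z xhat : nat -> 'rV[R]_n).

Definition gradf (y : 'rV[R]_n) (e : Xi) : 'rV[R]_n := grad (f ^~ e) y.

Definition eta (t : nat) : R :=
  kbar / (w + \sum_(1 <= i < t.+1) enorm (gradf (x i) (s i)) ^+ 2) `^ 3^-1.

(* Used for [1 <= t] only. *)
Definition beta (t : nat) : R := c * eta t.-1 ^+ 2.

Definition ftilde (t : nat) (y : 'rV[R]_n) : R :=
  fh y (x t) (s t)
  + (1 - beta t) * dot (y - x t) (z t - gradf (x t.-1) (s t)).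

Definition subobjective (t : nat) (y : 'rV[R]_n) : \bar R :=
  ((ftilde t y)%:E + u y)%E.

Record costa_run : Prop := CostaRun {
  costa_kbar : 0 < kbar;
  costa_w : 0 < w;
  costa_c : 0 < c;
  costa_eta0 : eta 0 < 1;
  costa_beta : forall t, beta t.+1 < 1;
  costa_x1 : x 1 = x 0;
  costa_x0 : feasible h g (x 0);
  costa_z1 : z 1 = gradf (x 0) (s 1%N);
  costa_zS : forall t, (1 <= t)%N ->
    z t.+1 = gradf (x t) (s t)
             + (1 - beta t) *: (z t - gradf (x t.-1) (s t));
  costa_xhat : forall t, (1 <= t)%N ->
    is_argmin (approx_feasible h gt (x t)) (subobjective t) (xhat t);
  costa_xS : forall t, (1 <= t)%N ->
    x t.+1 = (1 - eta t) *: x t + eta t *: xhat t }.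

Record kkt (t : nat) (lam : 'rV[R]_J) (nu : 'rV[R]_I) : Prop := Kkt {
  kkt_g : forall j, gt j (xhat t) (x t) <= 0;
  kkt_h : forall i, h i (xhat t) <= 0;
  kkt_lam : forall j, 0 <= lam ord0 j;
  kkt_nu : forall i, 0 <= nu ord0 i;
  kkt_slack_g : forall j, lam ord0 j * gt j (xhat t) (x t) = 0;
  kkt_slack_h : forall i, nu ord0 i * h i (xhat t) = 0;
  kkt_stationary : exists2 v, subdifferential u (xhat t) v &
    grad (ftilde t) (xhat t) + v
    + \sum_(j < J) lam ord0 j *: grad (gt j ^~ (x t)) (xhat t)
    + \sum_(i < I) nu ord0 i *: grad (h i) (xhat t) = 0 }.

End costa.

(* Main.v *)
(* By MFCQ there is a unit direction [v] at [x t] along which every nearly active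
   constraint decreases at rate [rho]. Moving by [rho / L] along [v] reaches a
   point [b] where every constraint of the subproblem is at most
   [- rho ^+ 2 / (2 * L)]: a nearly active one by the descent lemma, a slack one
   because it is Lipschitz. The surrogates [gt] are smooth on the feasible set
   only, so the original constraints are used first, to see that the whole segment
   to [b] is feasible. The KKT conditions make [xhat t] a minimiser of the
   Lagrangian, and evaluating the latter at [b] gives
   [(norm1 lam + norm1 nu) * rho ^+ 2 / (2 * L) <= obj b - obj (xhat t) <= BU]. *)
Require Import Defs.
From mathcomp Require Import ring lra.

Set Implicit Arguments.
Unset Strict Implicit.
Unset Printing Implicit Defensive.

Local Open Scope classical_set_scope.
Local Open Scope ring_scope.

(** * Inner product, gradients, and first-order inequalities for convex and smooth functions *)

Section euclidean.
Context {R : realType} {n : nat}.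
Implicit Types (a b v w : 'rV[R]_n) (A : set 'rV[R]_n) (phi : 'rV[R]_n -> R).

Lemma dotDl a b v : dot (a + b) v = dot a v + dot b v.
Proof. by rewrite /dot -big_split; apply: eq_bigr => i _; rewrite mxE mulrDl. Qed.

Lemma dotNl a v : dot (- a) v = - dot a v.
Proof. by rewrite /dot -sumrN; apply: eq_bigr => i _; rewrite mxE mulNr. Qed.

Lemma dotBl a b v : dot (a - b) v = dot a v - dot b v.
Proof. by rewrite dotDl dotNl. Qed.

Lemma dotZl (k : R) a v : dot (k *: a) v = k * dot a v.
Proof. by rewrite /dot big_distrr /=; apply: eq_bigr => i _; rewrite mxE mulrA. Qed.

Lemma dot0l v : dot 0 v = 0.
Proof. by rewrite -(subrr 0) dotBl subrr. Qed.

Lemma dot_suml m (a : 'I_m -> 'rV[R]_n) v :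
  dot (\sum_(i < m) a i) v = \sum_(i < m) dot (a i) v.
Proof. by elim/big_ind2: _ => [|? ? ? ? <- <-|]; rewrite ?dot0l ?dotDl. Qed.

Lemma dotC a b : dot a b = dot b a.
Proof. by apply: eq_bigr => i _; rewrite mulrC. Qed.

Lemma dot_ge0 a : 0 <= dot a a.
Proof. by apply: sumr_ge0 => i _; rewrite -expr2 sqr_ge0. Qed.

Lemma enorm_ge0 a : 0 <= enorm a.
Proof. exact: sqrtr_ge0. Qed.

Lemma enormZ (k : R) a : enorm (k *: a) = `|k| * enorm a.
Proof.
by rewrite /enorm dotZl dotC dotZl mulrA -expr2 sqrtrM ?sqr_ge0// sqrtr_sqr.
Qed.

Lemma sqr_enorm a : enorm a ^+ 2 = dot a a.
Proof. by rewrite sqr_sqrtr ?dot_ge0. Qed.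

Lemma enorm_eq0 a : enorm a = 0 -> a = 0.
Proof.
move=> a0; apply/rowP => i; rewrite mxE; apply/eqP; rewrite -sqrf_eq0 expr2.
have /eqP : dot a a = 0 by rewrite -sqr_enorm a0 expr0n.
rewrite /dot psumr_eq0 => [/allP/(_ i (mem_index_enum _))//|j _].
by rewrite -expr2 sqr_ge0.
Qed.

(** Cauchy-Schwarz, by expanding the square of [enorm b *: a - enorm a *: b]; the null vectors are
    treated first so that one can divide by the norms. *)
Lemma dot_le_enorm a b : dot a b <= enorm a * enorm b.
Proof.
have [/enorm_eq0->|a0] := eqVneq (enorm a) 0.
  by rewrite dot0l mulr_ge0 ?enorm_ge0.
have [/enorm_eq0->|b0] := eqVneq (enorm b) 0.
  by rewrite dotC dot0l mulr_ge0 ?enorm_ge0.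
have ab0 : 0 < 2 * (enorm a * enorm b).
  by rewrite !mulr_gt0// lt_def ?a0 ?b0 enorm_ge0.
have := dot_ge0 (enorm b *: a - enorm a *: b).
rewrite dotBl !dotZl ![dot _ (_ - _)]dotC !dotBl !dotZl -!sqr_enorm (dotC b a).
set p := _ - _.
have -> : p = 2 * (enorm a * enorm b) * (enorm a * enorm b - dot a b).
  by rewrite /p; ring.
by rewrite pmulr_rge0// subr_ge0.
Qed.

Lemma grad_derive phi a v :
  differentiable phi a -> 'D_v phi a = dot (grad phi a) v.
Proof.
move=> dphi; rewrite deriveE// {1}(row_sum_delta v) linear_sum.
apply: eq_bigr => i _; rewrite linearZ mxE deriveE// mulrC; congr (_ * _).
Qed.

Lemma is_derive_line phi a v (s : R) : differentiable phi (a + s *: v) ->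
  is_derive s 1 (fun r : R => phi (a + r *: v)) (dot (grad phi (a + s *: v)) v).
Proof.
move=> dphi; rewrite -grad_derive//.
(* The difference quotients of the restriction to the line are those of [phi] in direction [v], so
   derivability and value both transfer. *)
have E : (fun r : R => r^-1 *:
      (((fun r' : R => phi (a + r' *: v)) \o shift s) (r *: 1)
        - phi (a + s *: v))) =
    (fun r => r^-1 *:
      ((phi \o shift (a + s *: v)) (r *: v) - phi (a + s *: v))).
  apply/funext => r /=; congr (_ *: (phi _ - _)).
  by rewrite [r *: 1]mulr1 scalerDl addrCA.
split; first by rewrite /derivable E; exact: diff_derivable.
by rewrite /derive E.
Qed.

(** Convexity bounds the difference quotients at [a] towards [b] by [phi b - phi a]; let [t] tend to
    0 from the right. Convexity is asked on one segment only, so that functions convex on a subset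
    are covered. *)
Lemma convex_grad_le phi a b : differentiable phi a ->
  (forall t : R, 0 <= t <= 1 ->
    phi (t *: b + (1 - t) *: a) <= t * phi b + (1 - t) * phi a) ->
  phi a + dot (grad phi a) (b - a) <= phi b.
Proof.
move=> dphi cvx; rewrite -lerBrDl -grad_derive//.
have := @diff_derivable _ _ _ phi a (b - a) dphi.
move=> /cvg_dnbhs_at_right/cvgr_to_le; apply.
near=> t; have t0 : 0 < t by near: t; exact: nbhs_right_gt.
have t1 : t <= 1 by near: t; exact: nbhs_right_le.
rewrite /= [X in X <= _]mulrC ler_pdivrMr//.
have := cvx t; rewrite (ltW t0) t1 => /(_ isT).
have -> : t *: (b - a) + a = t *: b + (1 - t) *: a.
  by rewrite scalerBr scalerBl scale1r -addrA [- _ + _]addrC.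
by move=> h; lra.
Unshelve. all: by end_near. Qed.

Lemma convex_set_segment A a b (t : R) : @convex_set R 'rV[R]_n A ->
  A a -> A b -> 0 <= t <= 1 -> A (t *: a + (1 - t) *: b).
Proof.
move=> cA Aa Ab t01; pose p : {i01 R} := Itv01 (andP t01).1 (andP t01).2.
by have := cA a b p; rewrite !inE; apply.
Qed.

Lemma convex_function_grad_le A phi a b : @convex_function R 'rV[R]_n A phi ->
  A a -> A b -> differentiable phi a ->
  phi a + dot (grad phi a) (b - a) <= phi b.
Proof.
move=> cphi Aa Ab dphi; apply: convex_grad_le => // t t01.
pose p : {i01 R} := Itv01 (andP t01).1 (andP t01).2.
by have := cphi p b a; rewrite !inE; apply.
Qed.

(** The descent lemma along a segment inside [A]. Subtracting the linear and quadratic terms from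
    [phi] leaves [psi], whose derivative is nonpositive by Cauchy-Schwarz and the Lipschitz
    gradient; the mean value theorem concludes. *)
Lemma smooth_in_le A L phi a v (S : R) : smooth_in A L phi -> 0 <= S ->
  (forall s, 0 <= s <= S -> A (a + s *: v)) ->
  phi (a + S *: v) <=
    phi a + S * dot (grad phi a) v + L / 2 * S ^+ 2 * enorm v ^+ 2.
Proof.
move=> [dphi Lphi] S0 seg.
pose k := dot (grad phi a) v.
pose psi (s : R) := phi (a + s *: v) - s * k - L / 2 * s ^+ 2 * enorm v ^+ 2.
pose dpsi (s : R) := dot (grad phi (a + s *: v)) v - k - L * s * enorm v ^+ 2.
have Dpsi (s : R) : 0 <= s <= S -> is_derive s 1 psi (dpsi s).
  move=> /seg /dphi /is_derive_line H.
  rewrite /psi; apply: is_derive_eq.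
  by rewrite /dpsi /GRing.scale /=; field.
have Aa : A a by have := seg 0; rewrite scale0r addr0 lexx S0; exact.
have dle (s : R) : 0 <= s <= S -> dpsi s <= 0.
  move=> s0S; rewrite /dpsi -dotBl subr_le0.
  apply: (le_trans (dot_le_enorm _ _)).
  rewrite expr2 mulrA ler_wpM2r ?enorm_ge0//.
  apply: (le_trans (Lphi _ _ (seg _ s0S) Aa)).
  by rewrite addrAC subrr add0r enormZ ger0_norm ?mulrA//; case/andP: s0S.
have [||s sS /eqP] := @MVT_segment R psi dpsi 0 S S0.
- by move=> s; rewrite in_itv/= => /andP[s0 sS]; apply: Dpsi; rewrite !ltW.
- apply: derivable_within_continuous => s; rewrite in_itv/= => sS.
  exact: (@ex_derive _ _ _ _ _ _ _ (Dpsi s sS)).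
rewrite in_itv/= in sS; rewrite subr0 subr_eq => /eqP psiS.
have : psi S <= psi 0 by rewrite psiS gerDr mulr_le0_ge0// dle.
rewrite /psi scale0r addr0 -/k; lra.
Qed.

End euclidean.

(** * Constraints along the MFCQ direction, and their multipliers *)

Section constraints.
Context {R : realType} {n : nat}.
Implicit Types (a b v : 'rV[R]_n) (A : set 'rV[R]_n) (phi : 'rV[R]_n -> R).

(* The first case is the descent lemma, [- rho * S + L * S ^+ 2 / 2 <= - rho * S / 2];
   in the second the constraint is so slack that being Lipschitz suffices. *)
Lemma mfcq_step_le A phi a v (L G chi rho S : R) :
  smooth_in A L phi -> lipschitz_in A G phi ->
  0 < L -> 0 < rho -> rho / L * (G + rho / 2) <= chi ->
  enorm v = 1 -> phi a <= 0 ->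
  (- chi <= phi a -> dot (grad phi a) v <= - rho) ->
  0 <= S <= rho / L -> (forall s, 0 <= s <= S -> A (a + s *: v)) ->
  phi (a + S *: v) <= - (rho * S / 2).
Proof.
move=> smphi lipphi L0 rho0 hchi v1 phia0 act /andP[S0 SL] seg.
have [->|Sn0] := eqVneq S 0; first by rewrite scale0r addr0 mulr0 mul0r oppr0.
have {Sn0}S_gt0 : 0 < S by rewrite lt_def Sn0.
have [/act grd|lt_chi] := lerP (- chi) (phi a).
  apply: (le_trans (smooth_in_le smphi S0 seg)); rewrite v1.
  have : L * S <= rho by rewrite mulrC -ler_pdivlMr.
  by nra.
have Aa : A a by have := seg 0; rewrite scale0r addr0 lexx S0; exact.
have AS : A (a + S *: v) by apply: seg; rewrite S0 lexx.
have := lipphi _ _ AS Aa.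
rewrite addrAC subrr add0r enormZ v1 mulr1 (ger0_norm S0) => lip.
(* The sign of [G] is read off the Lipschitz bound between two points at distance [S > 0]. *)
have G0 : 0 <= G by rewrite -(pmulr_lge0 _ S_gt0); exact: le_trans (normr_ge0 _) lip.
have {}lip := le_trans (ler_norm _) lip.
(* With [q = rho / L], the new value is at most [- chi + G * q <= - rho * q / 2 <= - rho * S / 2]:
   this is where the lower bound on [chi] enters. *)
have : G * S <= G * (rho / L) by rewrite ler_wpM2l.
have : rho * S <= rho * (rho / L) by rewrite ler_wpM2l// ltW.
move: hchi; set q := rho / L; nra.
Qed.

(** By complementary slackness, the [j]-th term is at most [lam ord0 j * (gs j b - gs j a) = lam
    ord0 j * gs j b]. It serves for both families of constraints. *)
Lemma multipliers_le m (lam : 'rV[R]_m) (gs : 'I_m -> 'rV[R]_n -> R) a b (e : R) :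
  (forall j, 0 <= lam ord0 j) -> (forall j, lam ord0 j * gs j a = 0) ->
  (forall j, gs j a + dot (grad (gs j) a) (b - a) <= gs j b) ->
  (forall j, gs j b <= - e) ->
  dot (\sum_(j < m) lam ord0 j *: grad (gs j) a) (b - a) <= - (norm1 lam * e).
Proof.
move=> lam0 slack grd gb; rewrite dot_suml -mulrN /norm1 mulr_suml.
apply: ler_sum => j _; rewrite dotZl ger0_norm//.
apply: (le_trans (y := lam ord0 j * (gs j b - gs j a))).
  by rewrite ler_wpM2l// lerBrDl.
by rewrite mulrBr slack subr0 ler_wpM2l.
Qed.

End constraints.

(** * Feasibility of the iterates, and convexity of the surrogate objective *)

Section costa.
Context {R : realType} {n I J : nat} {Xi : Type}.
Variables (f : 'rV[R]_n -> Xi -> R) (u : 'rV[R]_n -> \bar R).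
Variables (h : 'I_I -> 'rV[R]_n -> R) (g : 'I_J -> 'rV[R]_n -> R).
Variables (fh : 'rV[R]_n -> 'rV[R]_n -> Xi -> R).
Variables (gt : 'I_J -> 'rV[R]_n -> 'rV[R]_n -> R).
Variables (kbar w c : R).
Variables (s : nat -> Xi) (x z xhat : nat -> 'rV[R]_n).

Lemma eta_ge0 t : 0 < kbar -> 0 <= eta f kbar w s x t.
Proof. by move=> k0; rewrite /eta divr_ge0 ?powR_ge0// ltW. Qed.

(** The squared gradients only enlarge the denominator, so [eta 0 < 1] makes every update a convex
    combination. *)
Lemma eta_le_eta0 t : 0 < kbar -> 0 < w ->
  eta f kbar w s x t <= eta f kbar w s x 0.
Proof.
move=> k0 w0; rewrite /eta [in leRHS]big_geq// addr0 ler_pM2l//.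
have w_le : w <= w + \sum_(1 <= i < t.+1) enorm (gradf f (x i) (s i)) ^+ 2.
  by rewrite lerDl; apply: sumr_ge0 => i _; rewrite sqr_ge0.
rewrite lef_pV2 ?posrE ?powR_gt0 ?(lt_le_trans w0)//.
by apply: ge0_ler_powR; rewrite ?nnegrE ?(ltW w0)// (le_trans (ltW w0)).
Qed.

Lemma approx_feasible_base y : feasible h g y -> (forall j, g j y = gt j y y) ->
  approx_feasible h gt y y.
Proof. by move=> [hy gy] gE; split=> // j; rewrite /= -gE; exact: gy. Qed.

(** The feasible set may be non-convex, so each update is placed in the convex set
    [approx_feasible h gt (x t)], which contains [xhat t], and also [x t] because the surrogates are
    tight there. *)
Lemma costa_feasible t :
  costa_run f u h g fh gt kbar w c s x z xhat ->
  (forall y, feasible h g y ->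
    [/\ @convex_set R 'rV[R]_n (approx_feasible h gt y),
        approx_feasible h gt y `<=` feasible h g &
        forall j, g j y = gt j y y]) ->
  (1 <= t)%N -> feasible h g (x t).
Proof.
move=> run sub; case: t => // t _; elim: t => [|t IH].
  by rewrite (costa_x1 run); exact: costa_x0 run.
have [cvx sub_f gE] := sub _ IH.
apply: sub_f; rewrite (costa_xS run (ltn0Sn t)) addrC.
apply: convex_set_segment => //.
- by have [] := costa_xhat run (ltn0Sn t).
- exact: approx_feasible_base.
- rewrite eta_ge0 ?(costa_kbar run)//=.
  apply: le_trans (ltW (costa_eta0 run)).
  by apply: eta_le_eta0; [exact: costa_kbar run|exact: costa_w run].
Qed.

Lemma differentiable_dotl (a b y : 'rV[R]_n) :
  differentiable (fun y' => dot (y' - a) b) y.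
Proof.
have -> : (fun y' => dot (y' - a) b) =
    \sum_(i < n) (fun y' : 'rV[R]_n => (y' ord0 i - a ord0 i) * b ord0 i).
  by apply/funext => y'; rewrite fct_sumE; apply: eq_bigr => i _; rewrite !mxE.
apply: differentiable_sum => i.
apply: differentiableM => //; apply: differentiableB => //.
exact: differentiable_coord.
Qed.

(** The correction term is affine in [y], so [ftilde] inherits the convexity of [fh]; the quadratic
    term of strong convexity has a favourable sign and is dropped. *)
Lemma ftilde_grad_le mu L t a b : 0 <= mu ->
  strongly_convex mu (fun y => fh y (x t) (s t)) ->
  smooth_in setT L (fun y => fh y (x t) (s t)) ->
  ftilde f fh kbar w c s x z t a
    + dot (grad (ftilde f fh kbar w c s x z t) a) (b - a) <=
  ftilde f fh kbar w c s x z t b.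
Proof.
move=> mu0 cvx [dfh _]; apply: convex_grad_le.
  apply: differentiableD; first exact: dfh.
  apply: differentiableM; first exact: differentiable_cst.
  exact: differentiable_dotl.
move=> r r01; rewrite /ftilde !dotBl dotDl !dotZl.
set p := dot (x t) _; set q := dot a _; set q' := dot b _.
have := cvx b a r r01; have : 0 <= mu / 2 * (r * (1 - r)) * enorm (b - a) ^+ 2.
  have /andP[r0 r1] := r01.
  by rewrite mulr_ge0 ?sqr_ge0// mulr_ge0 ?divr_ge0// mulr_ge0// subr_ge0.
set m := mu / 2 * _ * _; set F := fh (_ + _) _ _ => m0 H.
lra.
Qed.

End costa.

Theorem lemma5 (R : realType) (n I J : nat) (d d' : measure_display)
  (Omega : measurableType d) (Xi : measurableType d') (P : probability Omega R)
  (xi : {RV P >-> Xi}) (xis : nat -> {RV P >-> Xi})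
  (f : 'rV[R]_n -> Xi -> R) (u : 'rV[R]_n -> \bar R)
  (h : 'I_I -> 'rV[R]_n -> R) (g : 'I_J -> 'rV[R]_n -> R)
  (fh : 'rV[R]_n -> 'rV[R]_n -> Xi -> R)
  (gt : 'I_J -> 'rV[R]_n -> 'rV[R]_n -> R)
  (L G mu chi rho BU kbar w c : R)
  (* standing assumptions on the problem *)
  (Hiid : iid_samples xi xis)
  (Hfmeas : forall x, measurable_fun setT (f x))
  (Hfdiff : forall e x, differentiable (f ^~ e) x)
  (Hu : econvex u)
  (Hh : forall i, @convex_function R 'rV[R]_n setT (h i))
  (HF : exists m : R, forall x, feasible h g x -> (m%:E <= objective xi f u x)%E)
  (HL : 0 < L) (Hmu : 0 < mu)
  (* the subproblems are convex *)
  (Hsub : forall y, feasible h g y ->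
     [/\ @convex_set R 'rV[R]_n (approx_feasible h gt y),
         forall j, @convex_function R 'rV[R]_n (approx_feasible h gt y) (gt j ^~ y) &
         approx_feasible h gt y `<=` feasible h g])
  (* (i) *)
  (Hdom : feasible h g `<=` domain (objective xi f u) h g)
  (* (ii) *)
  (Hhs : forall i, smooth_in setT L (h i) /\ lipschitz_in setT G (h i))
  (Hgs : forall j, smooth_in setT L (g j) /\ lipschitz_in setT G (g j))
  (* (iii) *)
  (Hchi : 0 <= chi) (Hrho : 0 < rho) (Hmfcq : mfcq h g chi rho)
  (Hchirho : rho / L * (G + rho / 2) <= chi)
  (* (iv) *)
  (Hfh : forall y e, feasible h g y ->
     [/\ strongly_convex mu (fun x => fh x y e),
         smooth_in setT L (fun x => fh x y e) &
         grad (fun x => fh x y e) y = grad (f ^~ e) y])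
  (* (v) *)
  (Hgt : forall j y, feasible h g y ->
     [/\ convex_in (feasible h g) (gt j ^~ y),
         smooth_in (feasible h g) L (gt j ^~ y),
         lipschitz_in (feasible h g) G (gt j ^~ y),
         grad (gt j ^~ y) y = grad (g j) y &
         (forall x, feasible h g x -> g j x <= gt j x y) /\ g j y = gt j y y])
  (* a realisation of the algorithm, with the dual variables *)
  (omega : Omega) (x z xhat : nat -> 'rV[R]_n)
  (lam : nat -> 'rV[R]_J) (nu : nat -> 'rV[R]_I)
  (Hrun : costa_run f u h g fh gt kbar w c (fun t => xis t omega) x z xhat)
  (Hkkt : forall t, (1 <= t)%N ->
     kkt f u h fh gt kbar w c (fun t => xis t omega) x z xhat t (lam t) (nu t))
  (* (vi) *)
  (HBU : let obj := subobjective f u fh kbar w c (fun t => xis t omega) x z in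
     forall t y, (1 <= t)%N -> feasible h g y ->
       (obj t y - ereal_inf (obj t @` approx_feasible h gt (x t)) <= BU%:E)%E) :
  forall t, (1 <= t)%N ->
    norm1 (lam t) + norm1 (nu t) <= 2 * BU * L / rho ^+ 2.
Proof.
move=> t t1.
have feas : feasible h g (x t).
  apply: (costa_feasible Hrun) => // y Fy; have [? _ ?] := Hsub _ Fy.
  by split=> // j; have [_ _ _ _ []] := Hgt j _ Fy.
have [cvxA cvxg subA] := Hsub _ feas.
have fin_u y : feasible h g y -> u y \is a fin_num.
  by move=> /Hdom[[]]; rewrite /edom /objective /= fin_numD => /andP[].
have [v [v1 actg acth]] := Hmfcq _ feas.
(* This step length minimises the descent bound [- rho * s + L * s ^+ 2 / 2]. *)
set q := rho / L; pose b := x t + q *: v.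
have q0 : 0 < q by rewrite divr_gt0.
have gstep j s : 0 <= s <= q -> g j (x t + s *: v) <= - (rho * s / 2).
  move=> sq; have [sm lip] := Hgs j.
  exact: (mfcq_step_le sm lip HL Hrho Hchirho v1 (feas.2 j) (actg j) sq).
have hstep i s : 0 <= s <= q -> h i (x t + s *: v) <= - (rho * s / 2).
  move=> sq; have [sm lip] := Hhs i.
  exact: (mfcq_step_le sm lip HL Hrho Hchirho v1 (feas.1 i) (acth i) sq).
have segF s : 0 <= s <= q -> feasible h g (x t + s *: v).
  move=> sq; have rs0 : - (rho * s / 2) <= 0.
    by rewrite oppr_le0 !mulr_ge0 ?(ltW Hrho)//; case/andP: sq.
  by split=> k /=; apply: le_trans rs0; [exact: hstep|exact: gstep].
have qq : 0 <= q <= q by rewrite (ltW q0) lexx.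
pose e := rho * q / 2.
have e0 : 0 <= e by rewrite /e divr_ge0// mulr_ge0// ltW.
(* At [x t] the surrogate and [g j] share value and gradient, so [v] is a descent direction for the
   surrogate as well; [segF] keeps the segment where it is smooth. *)
have gtb j : gt j b (x t) <= - e.
  have [_ sm lip gradE [_ gE]] := Hgt j _ feas.
  apply: (mfcq_step_le sm lip HL Hrho Hchirho v1 _ _ qq segF).
    by rewrite -gE; exact: feas.2.
  by rewrite -gE gradE; exact: actg.
have Fb : feasible h g b by exact: segF.
have hb i : h i b <= - e by exact: hstep.
have [Axhat optx] := costa_xhat Hrun t1.
have Fxhat := subA _ Axhat.
(* This puts [b] in the set on which [cvxg] gives convexity of the surrogates. *)
have Ab : approx_feasible h gt (x t) b.
  by split; [exact: Fb.1|move=> j /=; apply: le_trans (gtb j) _; rewrite oppr_le0].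
case: (Hkkt _ t1) => _ _ lam0 nu0 slackg slackh [w' subw' stat].
have [cvxf smf _] := Hfh _ (xis t omega) feas.
have fgrad := @ftilde_grad_le _ _ _ f fh kbar w c (fun t => xis t omega) x z mu L t
  (xhat t) b (ltW Hmu) cvxf smf.
have gsum : dot (\sum_(j < J) lam t ord0 j *: grad (gt j ^~ (x t)) (xhat t))
    (b - xhat t) <= - (norm1 (lam t) * e).
  apply: (multipliers_le (gs := fun j => gt j ^~ (x t)) lam0 slackg) => // j.
  apply: (convex_function_grad_le (cvxg j)) => //.
  by have [_ [+ _] _ _ _] := Hgt j _ feas; exact.
have hsum : dot (\sum_(i < I) nu t ord0 i *: grad (h i) (xhat t))
    (b - xhat t) <= - (norm1 (nu t) * e).
  apply: (multipliers_le nu0 slackh) => // i.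
  apply: (convex_function_grad_le (Hh i)) => //.
  by have [[+ _] _] := Hhs i; exact.
have usub := subw' b.
have bu := HBU t b t1 Fb.
set ft := ftilde _ _ _ _ _ _ _ _ _ in fgrad stat.
set obj := subobjective _ _ _ _ _ _ _ _ _ _ in bu.
(* The infimum is at most [obj (xhat t)], so subtracting the latter instead can only decrease the
   gap. *)
have {bu}bu : (obj b - obj (xhat t) <= BU%:E)%E.
  apply: le_trans bu; apply: leeB => //; apply: ereal_inf_lbound.
  by exists (xhat t).
have objE y : obj y = ((ft y)%:E + u y)%E by [].
move: usub bu; rewrite !objE -(fineK (fin_u _ Fb)) -(fineK (fin_u _ Fxhat)).
rewrite -!EFinD !lee_fin => usub bu.
(* Pair stationarity with [b - xhat t]: [fgrad] and [usub] bound the first two terms by the increase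
   of the objective, [gsum] and [hsum] the others by minus the multipliers times [e]. *)
have := congr1 (fun p => dot p (b - xhat t)) stat; rewrite !dotDl dot0l => stat0.
have le_BU : (norm1 (lam t) + norm1 (nu t)) * e <= BU by lra.
have eE : e = rho ^+ 2 / (2 * L) by rewrite /e /q; field; rewrite gt_eqF.
have -> : 2 * BU * L / rho ^+ 2 = BU / e.
  by rewrite eE; field; rewrite !gt_eqF.
by rewrite ler_pdivlMr// /e divr_gt0// mulr_gt0.
Qed.
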